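(* Let $\lambda$ be a real number with $\lambda\ge-\frac12$, let $\Delta\ge 3$ be an integer, and let $U\in\mathcal{U}_{n,\Delta}$ (that is, $U$ is a unicyclic graph with $n$ vertices and maximum degree $\Delta$). Then the following hold. (i) If $2\lambda+6<\Delta<n-3$, then $$GRM_{\lambda}(U)\ge (\Delta+\lambda)(\Delta+\Delta\lambda+1)+(n-\Delta)(2+\lambda)^2+3(2+\lambda),$$ with equality if and only if $U\in\mathcal{U}^{(2)}_{n,\Delta}$. (ii) If $3\le\Delta<2\lambda+6$ or $n-3\le\Delta\le n-1$, then $$GRM_{\lambda}(U)\ge (\Delta+\lambda)(\Delta+\Delta\lambda+2)+(n-\Delta)(2+\lambda)^2,$$ with equality if and only if $U=U^{(3)}_{n,\Delta}$. (iii) If $\Delta=2\lambda+6$, then $$GRM_{\lambda}(U)\ge 6(2+\lambda)^3+(n-2\lambda-6)(2+\lambda)^2,$$ with equality if and only if either $U\in\mathcal{U}^{(2)}_{n,\Delta}$ or $U=U^{(3)}_{n,\Delta}$.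
   Context: All graphs are finite and simple. For a graph $\Gamma$ and a real number $\lambda$, the general reduced second Zagreb index is $$GRM_\lambda(\Gamma)=\sum_{ab\in E(\Gamma)}(\deg_{\Gamma}(a)+\lambda)(\deg_{\Gamma}(b)+\lambda).$$ A unicyclic graph is a connected graph with exactly one cycle. $\mathcal{U}_{n,\Delta}$ denotes the set of all unicyclic graphs with $n$ vertices and maximum degree $\Delta$. $\mathcal{U}^{(2)}_{n,\Delta}$ is the subset of $\mathcal{U}_{n,\Delta}$ consisting of the graphs $U_2$ on $n$ vertices obtained from the disjoint union of a cycle $C$ and a star $K_{1,\Delta-1}$ by adding a path of length at least $2$ between the center $a$ of $K_{1,\Delta-1}$ and a vertex $b$ of $C$. Thus $a$ has degree $\Delta$, is adjacent to $\Delta-1$ leaves and is not on the cycle, $b$ is the vertex of the cycle closest to $a$, $d(a,b)\ge2$, $\deg(b)=3$, and all other vertices have degree $1$ or $2$. $U^{(3)}_{n,\Delta}$ is the graph in $\mathcal{U}_{n,\Delta}$ obtained by identifying a vertex $a$ of the cycle $C_{n-(\Delta-2)}$ with the center of a star $K_{1,\Delta-2}$; thus $a$ lies on the cycle, has degree $\Delta$, is adjacent to $\Delta-2$ leaves, and all other vertices have degree $1$ or $2$. Equality of graphs is understood up to isomorphism. *)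

(* Defs.v *)
From mathcomp Require Import all_boot all_order all_algebra.
Set Implicit Arguments.
Unset Strict Implicit.
Unset Printing Implicit Defensive.
Import Order.TTheory GRing.Theory Num.Theory.

Record sgraph := SGraph {
  vertex :> finType;
  adj : rel vertex;
  adj_sym : symmetric adj;
  adj_irr : irreflexive adj }.

Section GraphNotions.
Variable G : sgraph.

Definition edges : {set {set G}} :=
  [set [set x; y] | x in G, y in G & adj x y].

Definition deg (x : G) : nat := #|[set y | adj x y]|.

Definition max_deg : nat := \max_(x in G) deg x.

Definition connected : Prop := forall x y : G, connect (@adj G) x y.

Definition cycle_edges (s : seq G) : {set {set G}} :=
  [set [set x; next s x] | x in s].

(** A cycle is identified with its edge set, so that the rotations and the
    reversal of a cyclic vertex sequence count as one cycle. *)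
Definition is_cycle (C : {set {set G}}) : Prop :=
  exists s : seq G, [/\ 2 < size s, ucycle (@adj G) s & C = cycle_edges s].

Definition unicyclic : Prop :=
  connected /\ exists! C : {set {set G}}, is_cycle C.

(** The inner product runs over the two ends of the edge [A]. *)
Definition GRM (R : realFieldType) (lambda : R) : R :=
  (\sum_(A in edges) \prod_(x in A) ((deg x)%:R + lambda))%R.

Definition in_U (n Delta : nat) : Prop :=
  [/\ unicyclic, #|G| = n & max_deg = Delta].

End GraphNotions.

Definition isomorphic (G H : sgraph) : Prop :=
  exists2 f : G -> H, bijective f & forall x y, adj (f x) (f y) = adj x y.

Section CycleGraph.
Variable k : nat.

(** This is the cycle C_k only for [2 < k]. *)
Definition cycle_adj : rel 'I_k :=
  fun i j => (i != j) && ((i.+1 == j %[mod k]) || (j.+1 == i %[mod k])).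

Lemma cycle_adj_sym : symmetric cycle_adj.
Proof. by move=> i j; rewrite /cycle_adj eq_sym orbC. Qed.

Lemma cycle_adj_irr : irreflexive cycle_adj.
Proof. by move=> i; rewrite /cycle_adj eqxx. Qed.

Definition cycle_graph : sgraph := SGraph cycle_adj_sym cycle_adj_irr.

End CycleGraph.

Section Star.
Variable m : nat.

(** K_{1,m}: the centre is [None], the leaves are the [Some i]. *)
Definition star_adj : rel (option 'I_m) := fun x y => isSome x != isSome y.

Lemma star_adj_sym : symmetric star_adj.
Proof. by move=> x y; rewrite /star_adj eq_sym. Qed.

Lemma star_adj_irr : irreflexive star_adj.
Proof. by move=> x; rewrite /star_adj eqxx. Qed.

Definition star : sgraph := SGraph star_adj_sym star_adj_irr.

Definition center : star := None.

End Star.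

Section DisjointUnion.
Variables G H : sgraph.

Definition dunion_adj : rel (G + H) := fun u v =>
  match u, v with
  | inl x, inl y => adj x y
  | inr x, inr y => adj x y
  | _, _ => false
  end.

Lemma dunion_adj_sym : symmetric dunion_adj.
Proof. by move=> [x|x] [y|y] //=; rewrite adj_sym. Qed.

Lemma dunion_adj_irr : irreflexive dunion_adj.
Proof. by move=> [x|x] /=; rewrite adj_irr. Qed.

Definition dunion : sgraph := SGraph dunion_adj_sym dunion_adj_irr.

End DisjointUnion.

Section AddPath.
Variables (G : sgraph) (a b : G) (l : nat).

(** Adds a path of length [l >= 2] from [a] to [b]; its [l - 1] new inner
    vertices are, in order from [a] to [b], the elements of ['I_l.-1]. *)
Definition add_path_adj : rel (G + 'I_l.-1) := fun u v =>
  let joined (x : G) (i : 'I_l.-1) :=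
    (x == a) && (i == 0 :> nat) || (x == b) && (i.+1 == l.-1) in
  match u, v with
  | inl x, inl y => adj x y
  | inl x, inr i => joined x i
  | inr i, inl x => joined x i
  | inr i, inr j => (i.+1 == j) || (j.+1 == i)
  end.

Lemma add_path_adj_sym : symmetric add_path_adj.
Proof. by move=> [x|i] [y|j] //=; rewrite ?(adj_sym x) // orbC. Qed.

Lemma add_path_adj_irr : irreflexive add_path_adj.
Proof. by move=> [x|i] /=; rewrite ?adj_irr // orbb -[X in _ == X]add0n -add1n eqn_add2r. Qed.

Definition add_path : sgraph := SGraph add_path_adj_sym add_path_adj_irr.

End AddPath.

Section Identify.
Variables (G H : sgraph) (x : G) (y : H).

(** The disjoint union of [G] and [H] with [x] and [y] identified; the merged
    vertex is represented by [inl x]. *)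
Definition identify_adj : rel (G + {v : H | v != y}) := fun p q =>
  match p, q with
  | inl u, inl v => adj u v
  | inr u, inr v => adj (val u) (val v)
  | inl u, inr v => (u == x) && adj y (val v)
  | inr v, inl u => (u == x) && adj y (val v)
  end.

Lemma identify_adj_sym : symmetric identify_adj.
Proof. by move=> [u|u] [v|v] //=; rewrite adj_sym. Qed.

Lemma identify_adj_irr : irreflexive identify_adj.
Proof. by move=> [u|u] /=; rewrite adj_irr. Qed.

Definition identify : sgraph := SGraph identify_adj_sym identify_adj_irr.

End Identify.

(** A cycle of length [k] and a star K_{1,Delta-1}, joined by a path of length
    [l] between the centre of the star and the vertex [b] of the cycle. *)
Definition U2_graph (Delta k l : nat) (b : cycle_graph k) : sgraph :=
  @add_path (dunion (cycle_graph k) (star Delta.-1))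
    (inr (center Delta.-1)) (inl b) l.

Definition in_U2 (n Delta : nat) (G : sgraph) : Prop :=
  in_U G n Delta /\
  exists k l : nat, [/\ 3 <= k, 2 <= l &
    exists b : cycle_graph k, isomorphic G (U2_graph Delta l b)].

(** For [2 <= Delta < n] the truncated subtractions are exact and the cycle has
    length at least 3. By symmetry the isomorphism type does not depend on
    the choice of [a]. *)
Definition U3_graph (n Delta : nat) (a : cycle_graph (n - (Delta - 2))) :
  sgraph := identify a (center (Delta - 2)).

Definition is_U3 (n Delta : nat) (G : sgraph) : Prop :=
  exists a : cycle_graph (n - (Delta - 2)), isomorphic G (U3_graph a).

(* Main.v *)
(** In a unicyclic graph, orient every edge off the cycle towards the cycle and
    the cycle itself in one direction: each vertex [v] then has exactly one
    out-neighbour [p v], and the edges are the pairs [v -- p v].  As the degrees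
    sum to [2 n], this gives
      GRM = n (2 + lam)^2 + sum_v (deg (p v) - 2) (deg v + lam),
    where every term of the sum is nonnegative because [p v] is never a leaf.
    Let [a] be a vertex of maximum degree.  If [a] is on the cycle, the terms with
    [p v = a] alone yield the bound of (ii).  Otherwise let [b] be the point where
    the orbit of [a] under [p] enters the cycle; the terms with [p v = a] or
    [p v = b] yield the bound of (i) if [p a <> b], and more than the bound of (ii)
    if [p a = b].  The two bounds differ by [Delta - 2 lam - 6]. *)

Require Import Defs.
From mathcomp Require Import all_boot all_order all_algebra.
From mathcomp Require Import zify ring lra.
Import Order.TTheory GRing.Theory Num.Theory.
Local Open Scope ring_scope.

Set Implicit Arguments.
Unset Strict Implicit.
Unset Printing Implicit Defensive.

(** * Orienting a unicyclic graph towards its cycle *)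

Section Orientation.
Local Open Scope nat_scope.

Lemma nth_next (T : eqType) (x0 : T) (s : seq T) i :
  uniq s -> i < size s -> next s (nth x0 s i) = nth x0 s (i.+1 %% size s).
Proof.
move=> us lti; rewrite next_nth mem_nth // index_uniq //.
case: s us lti => //= y s us; rewrite ltnS leq_eqVlt => /predU1P[->|lti].
  by rewrite nth_default // modnn.
by rewrite modn_small //; apply: set_nth_default.
Qed.

Lemma nth_iter_next (T : eqType) (x0 : T) (s : seq T) i m :
    uniq s -> i < size s ->
  iter m (next s) (nth x0 s i) = nth x0 s ((i + m) %% size s).
Proof.
move=> us lti; have s0 : 0 < size s by apply: leq_ltn_trans lti.
elim: m => [|m IHm]; first by rewrite addn0 modn_small.
rewrite iterS IHm nth_next ?ltn_pmod //; congr nth.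
by rewrite -addn1 modnDml addn1 addnS.
Qed.

(** [p] follows the cycle [s] in one direction and leads every other vertex one
    step closer to it; sending [x] to the edge [x -- p x] is then a bijection
    from the vertices to the edges. *)
Record oriented (G : sgraph) (s : seq G) (p : G -> G) : Prop := Oriented {
  or_size : 2 < size s;
  or_uniq : uniq s;
  or_next : {in s, p =1 next s};
  or_pp : forall x, p (p x) != x;
  or_adj : forall x y, adj x y = (y == p x) || (x == p y);
  or_reach : forall x, exists m, iter m p x \in s }.

(** [d] is the distance to [s]: some walk reaches [s] because [x0] lies in it, and the first step of
    a shortest one lowers the distance. *)
Lemma descent_function (G : sgraph) (s : seq G) (x0 : G) :
    connected G -> x0 \in s ->
  exists d : G -> nat, forall x, x \notin s -> exists2 y, adj x y & d y < d x.
Proof.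
move=> conG s_x0.
pose P x m := [exists t : m.-tuple G, path (@adj G) x t && (last x t \in s)].
have exP x : exists m, P x m.
  have /connectP[t xt lt] := conG x x0.
  by exists (size t); apply/existsP; exists (in_tuple t); rewrite xt -lt.
exists (fun x => ex_minn (exP x)) => x xs.
case: ex_minnP => -[|m] /existsP[t /andP[]].
  by rewrite (tuple0 t) /= (negPf xs).
case/tupleP: t => y t /= /andP[xy yt] lt _; exists y => //.
case: ex_minnP => m' _; apply; apply/existsP; exists t; exact/andP.
Qed.

(** A simple [T]-path from [x] to [y] is closed up by the edge [x -- y]. The cycle has at least
    three vertices, since a path of one step would put that edge in [T]. *)
Lemma missing_edge_cycle (G : sgraph) (T : rel G) (x y : G) :
    symmetric T -> subrel T (@adj G) -> connect T x y -> adj x y -> ~~ T x y ->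
  exists2 C, is_cycle C & [set x; y] \in C.
Proof.
move=> symT subT /connectP[t0 xt0 ->] xy nT.
case/shortenP: xt0 xy nT => t xt ut _ xy nT.
exists (cycle_edges (x :: t)).
  exists (x :: t); split=> //.
    case: t xt xy nT {ut} => [|z [|z' t]] //=; first by rewrite adj_irr.
    by case/andP=> ->.
  rewrite /ucycle ut andbT /= rcons_path adj_sym xy andbT.
  exact: sub_path xt.
apply/imsetP; exists (last x t); first exact: mem_last.
rewrite setUC; congr [set _; _].
by rewrite (last_nth x) nth_next //= modnn.
Qed.

(** The edges [x -- p x] already connect [G], so any further edge would close a cycle. By uniqueness
    this cycle is [s], but all edges of [s] have the form [x -- p x]. *)
Lemma unicyclic_oriented (G : sgraph) :
  unicyclic G -> exists s : seq G, exists p : G -> G, oriented s p.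
Proof.
case=> conG [_ [[s [s2 /andP[cs us] ->]] uC]].
case def_s: s (s2) => [//|x0 s'] _; have s_x0: x0 \in s by rewrite def_s mem_head.
have [d dP] := descent_function conG s_x0.
(* The default [x] is never taken: off the cycle [dP] supplies a neighbour to pick. *)
pose p x := if x \in s then next s x else odflt x [pick y | adj x y & d y < d x].
have pN x : x \notin s -> adj x (p x) /\ d (p x) < d x.
  move=> xs; rewrite /p (negPf xs); case: pickP => [y /andP[]//|no].
  by have [y xy yx] := dP x xs; have:= no y; rewrite xy yx.
have pS x : x \in s -> p x = next s x by rewrite /p => ->.
have p_s x : x \in s -> p x \in s by move=> xs; rewrite pS ?mem_next.
have adjp x : adj x (p x).
  have [xs|/pN[]//] := boolP (x \in s); rewrite pS //; exact: next_cycle.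
have ppx x : p (p x) != x.
  (* Off the cycle [d] decreases and the cycle is never left, so there is no way back; on the cycle
     two steps shift the index by 2 modulo [size s], which exceeds 2. *)
  apply/eqP=> pp; have [xs|xs] := boolP (x \in s); last first.
    have [_ lt1] := pN x xs.
    have [/p_s|/pN[_]] := boolP (p x \in s); first by rewrite pp (negPf xs).
    by rewrite pp ltnNge ltnW.
  move: pp; rewrite [p (p x)]pS ?p_s // pS //.
  have := nth_iter_next x 2 us; move/(_ (index x s)).
  rewrite index_mem nth_index // => /(_ xs) /= -> /eqP.
  rewrite -[X in _ == X](nth_index x xs) nth_uniq ?index_mem ?ltn_pmod //; last exact: ltn_trans s2.
  move: xs; rewrite -index_mem; move: (index x s) (size s) s2 => i k k2 ik.
  move/eqP=> e; have: i + 2 == i + 0 %[mod k] by rewrite addn0 e modn_small.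
  by rewrite eqn_modDl !modn_small //; apply: ltn_trans k2.
have reach x : exists m, iter m p x \in s.
  have [n] := ubnP (d x); elim: n x => // n IHn x; rewrite ltnS => xn.
  have [xs|xs] := boolP (x \in s); first by exists 0.
  have [_ lt1] := pN x xs; have [m ms] := IHn (p x) (leq_trans lt1 xn).
  by exists m.+1; rewrite iterSr.
exists s, p; split=> // x y.
set T : rel G := fun x y => (y == p x) || (x == p y).
have symT : symmetric T by move=> u v; rewrite /T orbC.
have subT : subrel T (@adj G).
  by move=> u v /orP[]/eqP->; rewrite // adj_sym.
apply/idP/idP; last exact: subT.
have csym := sym_connect_sym symT.
have conm u m : connect T u (iter m p u).
  elim: m => [|m IHm] //; apply: connect_trans IHm (connect1 _).
  by rewrite /T /= eqxx.
have cons u v : u \in s -> v \in s -> connect T u v.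
  move=> us' vs'; have s0 : 0 < size s by apply: ltn_trans s2.
  (* From [u] the walk completes the turn to the head of the list and then runs on to [v], whichever
     of the two comes first. *)
  have -> : v = iter (size s - index u s + index v s) p u.
    have nextp m : iter m p u \in s /\ iter m p u = iter m (next s) u.
      by elim: m => //= m [ms <-]; rewrite p_s // pS.
    rewrite (nextp _).2 -{2}(nth_index u us') nth_iter_next ?index_mem //.
    rewrite addnA subnKC; last by rewrite ltnW ?index_mem.
    by rewrite modnDl modn_small ?index_mem // nth_index.
  exact: conm.
have conT u v : connect T u v.
  have [m ms] := reach u; have [m' ms'] := reach v.
  apply: connect_trans (conm u m) _; rewrite csym.
  by apply: connect_trans (conm v m') _; apply: cons.
move=> xy; apply: contraT => nT.
have [C cC] := missing_edge_cycle symT subT (conT x y) xy nT.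
rewrite -(uC C cC) => /imsetP[z zs] /setP exyz.
have zx := exyz x; have zy := exyz y; rewrite !inE !eqxx ?orbT /= in zx zy.
have xny : x != y by apply: contraTneq xy => ->; rewrite adj_irr.
move: nT; rewrite /T negb_or => /andP[]; rewrite -!pS // in zx zy *.
case/esym/orP: zx => /eqP xz; case/esym/orP: zy => /eqP yz; subst;
  by rewrite ?eqxx // in xny *.
Qed.
End Orientation.

(** * Degrees and the index in terms of the orientation *)

Section Oriented.
Variables (G : sgraph) (s : seq G) (p : G -> G).
Hypothesis orG : oriented s p.
Local Open Scope nat_scope.

Let ppx := or_pp orG.

Lemma parent_neq (x : G) : p x != x.
Proof. by have := adj_irr x; rewrite (or_adj orG) eq_sym orbb => ->. Qed.

Lemma adj_parent x : adj x (p x).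
Proof. by rewrite (or_adj orG) eqxx. Qed.

(** The neighbours of [x] are its children under [p] and [p x], which by [or_pp] is not one of the
    children. *)
Lemma deg_preim (x : G) : deg x = #|[set v | p v == x]|.+1.
Proof.
rewrite (_ : _.+1 = #|p x |: [set v | p v == x]|); last by rewrite cardsU1 inE ppx.
apply: eq_card => y.
by rewrite !inE (or_adj orG) (eq_sym x).
Qed.

Lemma card_children (x : G) : #|[set v | p v == x]| = (deg x).-1.
Proof. by rewrite deg_preim. Qed.

Lemma deg_gt0 (x : G) : 0 < deg x. Proof. by rewrite deg_preim. Qed.

Lemma deg_parent x : 1 < deg (p x).
Proof. by rewrite deg_preim ltnS (cardD1 x) inE eqxx. Qed.

Lemma parent_prev x : x \in s -> p (prev s x) = x.
Proof.
by move=> xs; rewrite (or_next orG) ?mem_prev // next_prev // (or_uniq orG).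
Qed.

Lemma parent_mem x : x \in s -> p x \in s.
Proof. by move=> xs; rewrite (or_next orG) // mem_next. Qed.

Lemma deg_cycle (x : G) : x \in s -> 1 < deg x.
Proof. by move=> xs; rewrite -(parent_prev xs); apply: deg_parent. Qed.

Lemma sum_deg : \sum_(x : G) deg x = 2 * #|G|.
Proof.
under eq_bigr do rewrite deg_preim -addn1 -sum1_card.
rewrite big_split /= sum1_card mulSn mul1n; congr (_ + _).
rewrite -[RHS]sum1_card [RHS](partition_big p predT) //=.
by apply: eq_bigr => x _; apply: eq_bigl => v; rewrite inE.
Qed.

Local Open Scope ring_scope.
Variables (R : realFieldType) (lam : R).

(** Two distinct vertices giving the same edge would be each other's parents, against [or_pp]. *)
Lemma GRM_parents : GRM G lam = \sum_(v : G) ((deg v)%:R + lam) * ((deg (p v))%:R + lam).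
Proof.
rewrite /GRM.
have -> : edges G = [set [set v; p v] | v in G].
  apply/setP=> A; apply/imset2P/imsetP => [[x y _]|[v _ ->]]; last first.
    by exists v (p v); rewrite // inE adj_parent.
  rewrite inE (or_adj orG) => /= /orP[]/eqP-> ->; first by exists x.
  by exists y; rewrite // setUC.
rewrite big_imset /=; last first.
  move=> v w _ _ evw.
  have: v \in [set w; p w] by rewrite -evw set21.
  have: w \in [set v; p v] by rewrite evw set21.
  rewrite !inE => /predU1P[->//|/eqP wv] /predU1P[//|/eqP vw].
  by have := ppx w; rewrite -vw -wv eqxx.
apply: eq_bigr => v _; rewrite big_setU1 ?big_set1 //.
by rewrite inE eq_sym parent_neq.
Qed.

(** The part of the weight of the edge [v -- p v] above [(2 + lam) ^+ 2], up to
    a term [(2 + lam) * (deg v - 2)] whose sum over [v] is zero. *)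
Definition excess v : R := ((deg (p v))%:R - 2) * ((deg v)%:R + lam).

Lemma GRM_excess :
  GRM G lam = #|G|%:R * (2 + lam) ^+ 2 + \sum_(v : G) excess v.
Proof.
have sum_e : \sum_(v : G) ((deg v)%:R - 2 : R) = 0.
  by rewrite sumrB -natr_sum sum_deg sumr_const natrM -[2 *+ #|_|]mulr_natr subrr.
rewrite GRM_parents.
have -> : #|G|%:R * (2 + lam) ^+ 2
          = \sum_(v : G) (2 + lam) ^+ 2 + (2 + lam) * \sum_(v : G) ((deg v)%:R - 2).
  by rewrite sum_e mulr0 addr0 sumr_const mulr_natl.
rewrite mulr_sumr -!big_split /=.
by apply: eq_bigr => v _; rewrite /excess; ring.
Qed.

Hypothesis lam_ge : - (1 / 2) <= lam.

Lemma degl_gt0 (v : G) : 0 < (deg v)%:R + lam.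
Proof.
have : 1 <= (deg v)%:R :> R by rewrite ler1n deg_gt0.
move: lam_ge; lra.
Qed.

Lemma excess_ge0 v : 0 <= excess v.
Proof.
apply: mulr_ge0; last exact: ltW (degl_gt0 v).
by rewrite subr_ge0 ler_nat deg_parent.
Qed.

End Oriented.

(** * An isomorphism criterion, and the degrees in the constructed graphs *)

Section Models.
Local Open Scope nat_scope.

Lemma deg_sum (G : sgraph) (x : G) : deg x = \sum_(y : G) adj x y.
Proof.
rewrite /deg -sum1dep_card big_mkcond; apply: eq_bigr => y _.
by case: adj.
Qed.

(** The degrees around a branching vertex enter the index only through this sum, an isomorphism
    invariant that can be computed in the models. *)
Definition ndeg (G : sgraph) (x : G) : nat := \sum_(y : G) adj x y * deg y.

Lemma iso_deg (G H : sgraph) (f : G -> H) : bijective f ->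
  (forall x y, adj (f x) (f y) = adj x y) -> forall x, deg (f x) = deg x.
Proof.
move=> bf fa x; rewrite !deg_sum (reindex f) /=; last exact: onW_bij.
by apply: eq_bigr => y _; rewrite fa.
Qed.

Lemma iso_ndeg (G H : sgraph) (f : G -> H) : bijective f ->
  (forall x y, adj (f x) (f y) = adj x y) -> forall x, ndeg (f x) = ndeg x.
Proof.
move=> bf fa x; rewrite /ndeg (reindex f) /=; last exact: onW_bij.
by apply: eq_bigr => y _; rewrite fa (iso_deg bf fa).
Qed.

(* Comparing degrees forces the image of each neighbourhood to be a whole
   neighbourhood, so the image of [g] is a union of connected components. *)
Lemma iso_of_hom (G H : sgraph) (g : H -> G) (x0 : H) :
    connected G -> injective g ->
    (forall x y, adj x y -> adj (g x) (g y)) ->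
    (forall x, deg (g x) <= deg x) ->
  isomorphic G H.
Proof.
move=> conG injg homg degg.
have nbr x : [set z | adj (g x) z] = g @: [set y | adj x y].
  apply/esym/eqP; rewrite eqEcard card_imset // degg andbT.
  by apply/subsetP=> z /imsetP[y]; rewrite !inE => /homg xy ->.
have adjg x y : adj (g x) (g y) = adj x y.
  apply/idP/idP=> [xy|/homg//]; have : g y \in [set z | adj (g x) z] by rewrite inE.
  by rewrite nbr mem_imset // inE.
have codg z : z \in codom g.
  have /connectP[t xt ->] := conG (g x0) z.
  elim: t x0 xt => [|y t IHt] x0 /=; first by rewrite codom_f.
  case/andP=> xy; have : y \in [set z | adj (g x0) z] by rewrite inE.
  by rewrite nbr => /imsetP[y' _ ->]; apply: IHt.
have bijg : bijective g.
  apply: inj_card_bij => //; rewrite -(card_codom injg).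
  by apply: subset_leq_card; apply/subsetP=> z _; exact: codg.
have [f gK fK] := bijg.
by exists f => [|x y]; [exists g | rewrite -adjg !fK].
Qed.

Lemma iso_card (G H : sgraph) : isomorphic G H -> #|G| = #|H|.
Proof. by case=> f /bij_eq_card. Qed.

Lemma sum_eq_l (T : finType) (x : T) (F : T -> nat) :
  \sum_(y : T) (y == x) * F y = F x.
Proof.
by rewrite (bigD1 x) //= eqxx mul1n big1 ?addn0 // => y /negPf->.
Qed.

Lemma sum_eq1 (T : finType) (x : T) : \sum_(y : T) (y == x) = 1.
Proof. by rewrite -[RHS](sum_eq_l x (fun=> 1)); apply: eq_bigr => y; rewrite muln1. Qed.

Lemma sum_ord_eq (m c : nat) : \sum_(j < m) (c == j :> nat) = (c < m).
Proof.
case: (ltnP c m) => cm.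
  by rewrite -[RHS](sum_eq1 (Ordinal cm)); apply: eq_bigr => j _; rewrite eq_sym.
by rewrite big1 // => j _; case: eqP => // cj; rewrite cj leqNgt ltn_ord in cm.
Qed.

Lemma cycle_adjE k (i j : cycle_graph k) : 1 < k ->
  adj i j = (j == ordS i) || (i == ordS j).
Proof.
move=> k1; rewrite /= /cycle_adj -!val_eqE /=.
rewrite !(modn_small (ltn_ord _)) (eq_sym (nat_of_ord j)) (eq_sym (nat_of_ord i) (_ %% _)).
case: eqP => //= ij; apply/esym/negbTE; rewrite ij orbb.
rewrite -{2}(modn_small (ltn_ord j)) -addn1 -{2}(addn0 j) eqn_modDl mod0n modn_small //.
Qed.

Lemma ordS_ordS k (i : 'I_k) : 2 < k -> ordS (ordS i) != i.
Proof.
move=> k2; rewrite -val_eqE /= -addn1 modnDml -addn1 -addnA.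
rewrite -{2}(modn_small (ltn_ord i)) -{2}(addn0 i) eqn_modDl mod0n modn_small //.
Qed.

(** For [2 < k] the two neighbours of [i] differ, so the indicator of adjacency is the sum of two
    point indicators. *)
Lemma cycle_sum k (i : cycle_graph k) (F : 'I_k -> nat) : 2 < k ->
  \sum_(j : cycle_graph k) adj i j * F j = F (ordS i) + F (ord_pred i).
Proof.
move=> k2; rewrite -(sum_eq_l (ordS i)) -(sum_eq_l (ord_pred i)) -big_split /=.
apply: eq_bigr => j _; rewrite -mulnDl; congr (_ * _).
rewrite -[cycle_adj _ _]/(adj (i : cycle_graph k) j) cycle_adjE ?(ltn_trans _ k2) //.
rewrite (eq_sym i) (can2_eq (@ordSK k) (@ord_predK k)).
case: (j =P ordS i) => // ->.
by rewrite -(can2_eq (@ordSK k) (@ord_predK k)) (negPf (ordS_ordS i k2)).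
Qed.

Lemma cycle_deg k (i : cycle_graph k) : 2 < k -> deg i = 2.
Proof.
move=> k2; rewrite deg_sum; apply: etrans (cycle_sum i (fun=> 1) k2).
by apply: eq_bigr => j _; rewrite muln1.
Qed.

Lemma star_sum m (F : option 'I_m -> nat) :
  \sum_(j : star m) adj (center m) j * F j = \sum_(j < m) F (Some j).
Proof.
rewrite (bigD1 None) //= mul0n add0n (reindex_omap Some id) /=; last by case.
by apply: eq_big => j; rewrite ?eqxx ?mul1n.
Qed.

Lemma center_deg m : deg (center m) = m.
Proof.
rewrite deg_sum -[RHS](card_ord m) -sum1_card.
apply: etrans (star_sum (fun=> 1)).
by apply: eq_bigr => j _; rewrite muln1.
Qed.

Lemma leaf_deg m (i : 'I_m) : deg (Some i : star m) = 1.
Proof.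
rewrite deg_sum -[RHS](sum_eq1 (None : option 'I_m)).
by apply: eq_bigr; case.
Qed.

Lemma dunion_deg (G H : sgraph) :
  (forall x : G, deg (inl x : dunion G H) = deg x) *
  (forall y : H, deg (inr y : dunion G H) = deg y).
Proof.
split=> x; rewrite !deg_sum big_sumType /=; last by rewrite big1 ?add0n.
by rewrite [X in _ + X]big1 ?addn0.
Qed.

(** The ends of the path are [ord0] and [ord_max]. For [l = 2] they are one vertex, joined to both
    [a] and [b]. *)
Lemma add_path_degl (G : sgraph) (a b x : G) l : 2 <= l -> a != b ->
  deg (inl x : add_path a b l) = deg x + (x == a) + (x == b).
Proof.
case: l => [|[|l]] // _ ab; rewrite !deg_sum big_sumType -addnA; congr (_ + _) => /=.
rewrite -[(x == a) : nat]muln1 -(sum_eq1 (ord0 : 'I_l.+1)).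
rewrite -[(x == b) : nat]muln1 -(sum_eq1 (ord_max : 'I_l.+1)) !big_distrr -big_split /=.
apply: eq_bigr => i _; rewrite eqSS -!val_eqE /=.
by case: (x =P a) => [->|_]; rewrite ?(negPf ab) /= ?orbF; do 2?case: eqP.
Qed.

(** Each neighbour that an end of the path lacks among the inner vertices is made up by [a] or
    [b]. *)
Lemma add_path_degr (G : sgraph) (a b : G) l (i : 'I_l.-1) : 2 <= l -> a != b ->
  deg (inr i : add_path a b l) = 2.
Proof.
case: l i => [|[|l]] //= i _ ab; rewrite !deg_sum big_sumType /=.
have -> : \sum_(x : G) ((x == a) && (i == 0 :> nat) || (x == b) && (i.+1 == l.+1))
      = (i == 0 :> nat) + (i == l :> nat).
  rewrite -[nat_of_bool (i == 0 :> nat)]mul1n -(sum_eq1 a).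
  rewrite -[nat_of_bool (i == l :> nat)]mul1n -(sum_eq1 b) !big_distrl -big_split /=.
  apply: eq_bigr => x _; rewrite eqSS.
  by case: (x =P a) => [->|_]; rewrite ?(negPf ab) /= ?orbF; do ?case: eqP.
have -> : \sum_(j < l.+1) ((i.+1 == j) || (j.+1 == i)) = (i < l) + (0 < i).
  rewrite (_ : (i < l) = (i.+1 < l.+1)) //. rewrite -sum_ord_eq.
  have -> : (0 < i) = \sum_(j < l.+1) (j.+1 == i) :> nat.
    case: i => -[|i] il /=; first by rewrite big1.
    transitivity (i < l.+1 : nat); first by rewrite (ltnW il).
    by rewrite -sum_ord_eq; apply: eq_bigr => j _; rewrite eqSS eq_sym.
  rewrite -big_split; apply: eq_bigr => j _ /=; lia.
by have := ltn_ord i; rewrite ltnS; lia.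
Qed.

Lemma sum_neq (T : finType) (y : T) (F : T -> nat) :
  \sum_(v : {v : T | v != y}) F (val v) = \sum_(v | v != y) F v.
Proof. exact/esym/(big_sub [pred v | v != y]). Qed.

Lemma identify_degl (G H : sgraph) (x u : G) (y : H) :
  deg (inl u : identify x y) = deg u + (u == x) * deg y.
Proof.
rewrite !deg_sum big_sumType /=; congr (_ + _).
rewrite (sum_neq y (fun v => (u == x) && adj y v : nat)) [in RHS](bigD1 y) //=.
rewrite adj_irr add0n big_distrr /=.
by apply: eq_bigr => v _; rewrite -mulnb.
Qed.

(** The merged vertex [inl x] takes over the term of [y] in the degree sum. *)
Lemma identify_degr (G H : sgraph) (x : G) (y : H) (v : {v : H | v != y}) :
  deg (inr v : identify x y) = deg (val v).
Proof.
rewrite !deg_sum big_sumType /= (sum_neq y (fun w => adj (val v) w : nat)).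
rewrite [in RHS](bigD1 y) //=; congr (_ + _).
rewrite adj_sym -[RHS]mul1n -(sum_eq1 x) big_distrl /=.
by apply: eq_bigr => w _; rewrite mulnb.
Qed.

End Models.

(** * Values of the index on the extremal shapes, and the bound for a vertex on the cycle *)

(** Source of all equality cases: nonnegative gaps [F y - w y] with sum zero vanish one by one. *)
Lemma ler_sum_eq (R : numDomainType) (T : finType) (w F : T -> R) :
    (forall x, w x <= F x) ->
  \sum_x w x <= \sum_x F x /\
  (\sum_x F x = \sum_x w x -> forall x, F x = w x).
Proof.
move=> wF; split=> [|eqs x]; first exact: ler_sum.
apply/eqP; rewrite -subr_eq0; apply/eqP.
have/psumr_eq0P : forall y, true -> 0 <= F y - w y by move=> y _; rewrite subr_ge0.
by apply=> //; rewrite sumrB eqs subrr.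
Qed.

Lemma sum_mulrb (R : zmodType) (T : finType) (A : R) (P : pred T) :
  \sum_x A *+ P x = A *+ #|[set x | P x]|.
Proof.
by rewrite sumrMnr -sum1dep_card [in RHS]big_mkcond.
Qed.

Section Bounds.
Variables (R : realFieldType) (lam : R).
Hypothesis lam_ge : - (1 / 2) <= lam.

Definition bound_on (n Delta : nat) : R :=
  (Delta%:R + lam) * (Delta%:R + Delta%:R * lam + 2)
  + (n%:R - Delta%:R) * (2 + lam) ^+ 2.

Definition bound_off (n Delta : nat) : R :=
  (Delta%:R + lam) * (Delta%:R + Delta%:R * lam + 1)
  + (n%:R - Delta%:R) * (2 + lam) ^+ 2 + 3 * (2 + lam).

Variables (G : sgraph) (s : seq G) (p : G -> G).
Hypothesis orG : oriented s p.

Lemma ndeg_preim (x : G) : ndeg x = (deg (p x) + \sum_(v | p v == x) deg v)%N.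
Proof.
rewrite -(sum_eq_l (p x) (@deg G)) [X in (_ + X)%N]big_mkcond -big_split; apply: eq_bigr => y _ /=.
rewrite (or_adj orG) (eq_sym x).
case: (y =P p x) => [->|_] /=; last by case: eqP; rewrite ?mul1n.
by rewrite (negPf (or_pp orG x)) addn0.
Qed.

(** All children of [x] share the factor [deg x - 2], and their degrees add up to
    [ndeg x - deg (p x)]. *)
Lemma sum_excess_preim (x : G) :
  \sum_(v | p v == x) excess p lam v
  = ((deg x)%:R - 2) * ((ndeg x)%:R - (deg (p x))%:R + ((deg x)%:R - 1) * lam).
Proof.
transitivity (\sum_(v | p v == x) ((deg x)%:R - 2) * ((deg v)%:R + lam)).
  by apply: eq_bigr => v /eqP <-.
have suml : \sum_(v | p v == x) lam = ((deg x)%:R - 1) * lam.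
  rewrite sumr_const -cardsE (card_children orG) -[lam *+ _]mulr_natl -subn1 natrB //.
  exact: deg_gt0 orG x.
rewrite -mulr_sumr big_split /= -natr_sum suml ndeg_preim natrD; ring.
Qed.

Lemma excess_le2 (v : G) : (deg (p v) <= 2)%N -> excess p lam v = 0.
Proof.
move=> le2; have d2 : deg (p v) = 2%N.
  by apply/eqP; rewrite eqn_leq le2 (deg_parent orG).
by rewrite /excess d2 subrr mul0r.
Qed.
(** Only children of [a] have nonzero excess. The hypotheses are local degree data, so the
    orientation of [G] need not be matched with a cycle of the model. *)
Lemma GRM_shape_on (Delta : nat) (a : G) :
    deg a = Delta -> (forall x, x != a -> deg x <= 2)%N -> (2 < Delta)%N ->
    ndeg a = (Delta + 2)%N ->
  GRM G lam = bound_on #|G| Delta.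
Proof.
move=> da le2 D3 na; rewrite (GRM_excess orG) (bigID (fun v => p v == a)) /=.
rewrite sum_excess_preim da na [X in _ + (_ + X)]big1 => [|v /le2]; last exact: excess_le2.
have -> : deg (p a) = 2%N.
  by apply/eqP; rewrite eqn_leq (deg_parent orG) andbT le2 // (parent_neq orG).
rewrite natrD /bound_on; ring.
Qed.

(** Here the children of [a] and of [b] contribute. Non-adjacency keeps either vertex from being the
    parent of the other, so both parents have degree 2. *)
Lemma GRM_shape_off (Delta : nat) (a b : G) :
    a != b -> ~~ adj a b -> deg a = Delta -> deg b = 3%N ->
    (forall x, x != a -> x != b -> deg x <= 2)%N -> (2 < Delta)%N ->
    ndeg a = (Delta + 1)%N -> ndeg b = 6 ->
  GRM G lam = bound_off #|G| Delta.
Proof.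
move=> ab nab da db le2 D3 na nb.
rewrite (GRM_excess orG) (bigID (fun v => p v == a)) /= sum_excess_preim da na.
rewrite [X in _ + (_ + X)](bigID (fun v => p v == b)) /=.
rewrite [X in _ + (_ + (_ + X))]big1 => [|v /andP[va vb]]; last exact/excess_le2/le2.
rewrite (eq_bigl (fun v => p v == b)) => [|v]; last first.
  by case: eqP => [->|]; rewrite ?(negPf ab).
rewrite sum_excess_preim db nb.
have -> : deg (p a) = 2%N.
  apply/eqP; rewrite eqn_leq (deg_parent orG) andbT le2 // ?(parent_neq orG) //.
  by apply: contraNneq nab => <-; rewrite (adj_parent orG).
have -> : deg (p b) = 2%N.
  apply/eqP; rewrite eqn_leq (deg_parent orG) andbT le2 // ?(parent_neq orG) //.
  by apply: contraNneq nab => <-; rewrite adj_sym (adj_parent orG).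
rewrite natrD /bound_off; ring.
Qed.

Lemma bound_on_le (Delta : nat) (a : G) :
    a \in s -> deg a = Delta -> (2 < Delta)%N ->
  bound_on #|G| Delta <= GRM G lam /\
  (GRM G lam = bound_on #|G| Delta ->
    (forall x, x != a -> deg x <= 2)%N /\
    (forall v, p v = a -> v != prev s a -> deg v = 1%N)).
Proof.
move=> sa da D3; set q := prev s a; have pq : p q = a by rewrite (parent_prev orG).
have dq : (2 <= deg q)%N by rewrite (deg_cycle orG) // mem_prev.
pose D : R := Delta%:R - 2; have D0 : 0 < D.
  by rewrite subr_gt0 ltr_nat.
(* The excess of a child of [a] is at least its value [D * (1 + lam)] at a leaf; the child [q] on
   the cycle has degree at least 2, which adds another [D]. *)
pose w v := D * (1 + lam) *+ (p v == a) + D *+ (v == q).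
have sumw : \sum_v w v = bound_on #|G| Delta - #|G|%:R * (2 + lam) ^+ 2.
  rewrite big_split /= !sum_mulrb (card_children orG) da (_ : [set x | x == q] = [set q]).
    rewrite cards1 -[_ *+ _.-1]mulr_natl -subn1 natrB ?(ltn_trans _ D3) //.
    rewrite /bound_on /D; ring.
  by apply/setP=> v; rewrite !inE.
have degR (v : G) k : (k <= deg v)%N -> k%:R <= (deg v)%:R :> R by rewrite ler_nat.
have wF v : w v <= excess p lam v.
  rewrite /w; have [pva|pva] := eqVneq (p v) a; last first.
    case: eqP => [vq|_]; first by rewrite vq pq eqxx in pva.
    by rewrite addr0 (excess_ge0 orG).
  rewrite /excess pva da -/D mulr1n.
  have [->|_] := eqVneq v q; rewrite /= ?mulr1n ?mulr0n.
    by have := degR _ _ dq; nra.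
  by have := degR _ _ (deg_gt0 orG v); nra.
have [le_sum eq_sum] := ler_sum_eq wF.
rewrite (GRM_excess orG); split; first by move: le_sum; rewrite sumw; lra.
move=> eqB; have {}eq_sum v : excess p lam v = w v by apply: eq_sum; rewrite sumw; lra.
split=> [x xa|v pva vq]; last first.
  have := eq_sum v; rewrite /w /excess pva eqxx da (negPf vq) mulr0n mulr1n addr0.
  move/(mulfI (lt0r_neq0 D0))/addIr/eqP; rewrite -[1]/(1%:R) eqr_nat => /eqP.
  by [].
(* A childless vertex is a leaf. Otherwise a child of [x] has weight zero, hence excess zero, and
   this forces [deg x = 2]. *)
have [/existsP[v /eqP pvx]|no] := boolP [exists v, p v == x]; last first.
  rewrite (deg_preim orG) (_ : [set v | p v == x] = set0) ?cards0 //.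
  apply/setP=> v; rewrite !inE; apply: contraNF no => pvx; apply/existsP; by exists v.
have := eq_sum v; rewrite /w pvx (negPf xa).
have -> : (v == q) = false by apply: contraNF xa => /eqP vq; rewrite -pvx vq pq.
rewrite addr0 /excess pvx => /eqP; rewrite mulf_eq0 (gt_eqF (degl_gt0 orG lam_ge v)) orbF.
by rewrite subr_eq0 eqr_nat => /eqP->.
Qed.

End Bounds.

(** * Bounds for a vertex of maximum degree off the cycle *)

Section OffCycle.
Variables (G : sgraph) (s : seq G) (p : G -> G).
Hypothesis orG : oriented s p.

Lemma entry_point (a : G) : a \notin s ->
  exists m, iter m.+1 p a \in s /\ forall i, (i <= m)%N -> iter i p a \notin s.
Proof.
move=> sa; case: (ex_minnP (or_reach orG a)) => -[|m] sm minm.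
  by rewrite sm in sa.
exists m; split=> // i im; apply/negP=> /minm; by rewrite ltnNge im.
Qed.

(** If [p a] is off the cycle, the closed neighbourhood of [a] is disjoint from the cycle, as a
    child on the cycle would put [a] there too. This accounts for [deg a + 1] vertices and at least
    3 more. *)
Lemma parent_mem_of_card (a : G) :
  a \notin s -> (#|G| < deg a + 4)%N -> p a \in s.
Proof.
move=> sa; apply: contraTT => spa; rewrite -leqNgt.
pose N := a |: [set y | adj a y].
have cN : #|N| = (deg a).+1 by rewrite cardsU1 inE adj_irr.
have dis : N :&: [set y in s] = set0.
  apply/setP=> y; rewrite !inE; apply/negP=> /andP[/orP[/eqP->|]].
    by rewrite (negPf sa).
  rewrite (or_adj orG) => /orP[/eqP->|/eqP ay]; first by rewrite (negPf spa).
  by move/(parent_mem orG); rewrite -ay (negPf sa).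
have cs : #|[set y in s]| = size s by rewrite cardsE; apply/card_uniqP/or_uniq/orG.
have := cardsUI N [set y in s]; rewrite dis cards0 addn0 cN cs => eqc.
have := max_card (mem (N :|: [set y in s])); rewrite eqc.
by have := or_size orG; lia.
Qed.

Variables (a : G) (m : nat).
Hypotheses (sa : a \notin s) (sb : iter m.+1 p a \in s).
Hypothesis nsi : forall i, (i <= m)%N -> iter i p a \notin s.

(** If step [j] returned to the vertex of an earlier step [i], the remaining [m.+1 - j] steps to the
    cycle could be made from step [i], arriving too early. *)
Lemma iter_inj i j :
  (i <= m)%N -> (j <= m)%N -> iter i p a = iter j p a -> i = j.
Proof.
wlog lt_ij : i j / (i < j)%N => [wl im jm eij|].
  by case: (ltngtP i j) => // lt; [apply: wl | symmetry; apply: wl].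
move=> im jm eij; have : iter (m.+1 - j + i) p a \notin s by apply: nsi; lia.
by rewrite iterD eij -iterD subnK ?sb // ltnW.
Qed.

Let b := iter m.+1 p a.
Let w := iter m p a.
Let q := prev s b.

(** The entry point [b] has its parent and two distinct children: [q] on the cycle and [w], the last
    vertex of the orbit before the cycle. *)
Lemma entry_degs :
  [/\ p q = b, (2 <= deg q)%N, q != w, (3 <= deg b)%N & b != a].
Proof.
have pq : p q = b by rewrite (parent_prev orG).
have sq : q \in s by rewrite mem_prev.
have qw : q != w by apply: contraNneq (nsi (leqnn m)) => qw; rewrite -/w -qw.
have ba : b != a by apply: contraNneq sa => <-.
split=> //; first by rewrite (deg_cycle orG).
have c2 : #|[set q; w]| = 2%N by rewrite cards2 qw.
rewrite (deg_preim orG) ltnS -c2; apply: subset_leq_card; apply/subsetP=> v; rewrite !inE => /orP[]/eqP-> //.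
by rewrite pq.
Qed.

Variables (R : realFieldType) (lam : R) (Delta : nat).
Hypotheses (lam_ge : - (1 / 2) <= lam) (da : deg a = Delta) (D3 : (2 < Delta)%N).

(** A lower bound for [excess p lam v]; the parameter [t] allows for a better
    estimate at [w] when [w = a]. *)
Definition off_weight (t : R) v : R :=
  (Delta%:R - 2) * (1 + lam) *+ (p v == a) + (2 + lam) *+ (v == q) + t *+ (v == w).

(** As [deg b] is at least 3, the excess at [q] and at [w] is at least [deg + lam]. Since [b != a],
    neither of them is among the children of [a], so the estimates add up. *)
Lemma off_weight_le (t : R) : 0 <= t -> t <= (deg w)%:R + lam ->
  #|G|%:R * (2 + lam) ^+ 2 + (Delta%:R - 2) * (Delta%:R - 1) * (1 + lam)
    + (2 + lam) + t <= GRM G lam /\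
  (GRM G lam = #|G|%:R * (2 + lam) ^+ 2 + (Delta%:R - 2) * (Delta%:R - 1) * (1 + lam)
    + (2 + lam) + t ->
  forall v, excess p lam v = off_weight t v).
Proof.
move=> t0 tw; have [pq dq qw db ba] := entry_degs.
have pw : p w = b by [].
have sumw : \sum_v off_weight t v
    = (Delta%:R - 2) * (Delta%:R - 1) * (1 + lam) + (2 + lam) + t.
  rewrite !big_split /= !sum_mulrb (card_children orG) da.
  have set1E y : [set x | x == y] = [set y] :> {set G} by apply/setP=> v; rewrite !inE.
  rewrite !set1E !cards1 -[_ *+ _.-1]mulr_natl -subn1 natrB ?(ltn_trans _ D3) //.
  ring.
have degR (v : G) k : (k <= deg v)%N -> k%:R <= (deg v)%:R :> R by rewrite ler_nat.
have D0 : 3 <= Delta%:R :> R by rewrite ler_nat.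
have wF v : off_weight t v <= excess p lam v.
  rewrite /off_weight; have [pva|pva] := eqVneq (p v) a.
    have -> : (v == q) = false by apply: contraNF ba => /eqP vq; rewrite -pva vq pq.
    have -> : (v == w) = false by apply: contraNF ba => /eqP vq; rewrite -pva vq; apply/eqP.
    rewrite /excess pva da !mulr0n mulr1n !addr0.
    by have := degR _ _ (deg_gt0 orG v); nra.
  have b3 (v' : G) : 0 <= ((deg b)%:R - 3) * ((deg v')%:R + lam).
    apply: mulr_ge0; first by rewrite subr_ge0 degR.
    have := degl_gt0 orG lam_ge v'. lra.
  have [vq|_] := eqVneq v q.
    rewrite vq (negPf qw) /excess pq !mulr0n mulr1n.
    by have := degR _ _ dq; have := b3 q; nra.
  have [->|_] := eqVneq v w; last by rewrite !addr0 (excess_ge0 orG).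
  by rewrite /excess pw !mulr0n mulr1n !add0r; have := b3 w; nra.
have [le_sum eq_sum] := ler_sum_eq wF.
rewrite (GRM_excess orG); split; first by move: le_sum; rewrite sumw; lra.
move=> eqB; apply: eq_sum; rewrite sumw; lra.
Qed.

Lemma bound_off_le_far : p a \notin s ->
  bound_off lam #|G| Delta <= GRM G lam /\
  (GRM G lam = bound_off lam #|G| Delta ->
    [/\ deg b = 3, forall x, x != a -> x != b -> (deg x <= 2)%N
      & forall v, p v = a -> deg v = 1%N]).
Proof.
move=> spa; have [pq dq qw db ba] := entry_degs.
have m0 : (0 < m)%N by case: m sb spa => //= ->.
have dw : (2 <= deg w)%N by rewrite /w; case: m m0 => //= k _; rewrite (deg_parent orG).
have wa : w != a.
  by apply/negP=> /eqP/(@iter_inj m 0 (leqnn _) (leq0n _)) e; rewrite e in m0.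
have degR (v : G) k : (k <= deg v)%N -> k%:R <= (deg v)%:R :> R by rewrite ler_nat.
have D0 : 3 <= Delta%:R :> R by rewrite ler_nat.
(* Here [w] differs from [a] and is itself a parent, so its degree is at least 2. *)
have [||le_w eq_w] := @off_weight_le (2 + lam).
- by move: lam_ge; lra.
- by have := degR _ _ dw; lra.
have -> : bound_off lam #|G| Delta = #|G|%:R * (2 + lam) ^+ 2
    + (Delta%:R - 2) * (Delta%:R - 1) * (1 + lam) + (2 + lam) + (2 + lam).
  by rewrite /bound_off; ring.
split=> // /eq_w {}eq_w.
have pl v := degl_gt0 orG lam_ge v.
split=> [|x xa xb|v pva].
(* With [deg b] at least 4 the excess at [q] would be at least [2 * (2 + lam)], above its weight
   [2 + lam]. *)
- apply/eqP; rewrite eqn_leq db andbT leqNgt; apply/negP=> /degR db4.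
  have b4 : 0 <= ((deg b)%:R - 4) * ((deg q)%:R + lam).
    by apply: mulr_ge0; [rewrite subr_ge0 | have := pl q; lra].
  have := eq_w q; rewrite /off_weight /excess pq (negPf ba) eqxx (negPf qw).
  rewrite !mulr0n mulr1n addr0 add0r; have := degR _ _ dq; move: lam_ge; nra.
- have [/existsP[v /eqP pvx]|no] := boolP [exists v, p v == x]; last first.
    rewrite (deg_preim orG) (_ : [set v | p v == x] = set0) ?cards0 //.
    apply/setP=> v; rewrite !inE; apply: contraNF no => pvx; apply/existsP; by exists v.
  have := eq_w v; rewrite /off_weight pvx (negPf xa).
  have -> : (v == q) = false by apply: contraNF xb => /eqP vq; rewrite -pvx vq pq.
  have -> : (v == w) = false by apply: contraNF xb => /eqP vq; rewrite -pvx vq.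
  rewrite !addr0 /excess pvx => /eqP; rewrite mulf_eq0 (gt_eqF (pl v)) orbF.
  by rewrite subr_eq0 eqr_nat => /eqP->.
- have := eq_w v; rewrite /off_weight /excess pva eqxx da.
  have -> : (v == q) = false by apply: contraNF ba => /eqP vq; rewrite -pva vq pq.
  have -> : (v == w) = false by apply: contraNF ba => /eqP vq; rewrite -pva vq; apply/eqP.
  rewrite !mulr0n mulr1n !addr0 => eqv.
  apply/eqP; rewrite -(eqr_nat R); apply/eqP; nra.
Qed.

Lemma bound_on_lt_near : p a \in s -> bound_on lam #|G| Delta < GRM G lam.
Proof.
move=> spa; have m0 : m = 0%N.
  by case: m nsi => // k /(_ 1%N isT); rewrite /= spa.
have D0 : 3 <= Delta%:R :> R by rewrite ler_nat.
(* Now [w = a] has degree [Delta]; the resulting estimate exceeds [bound_on] by [2 * (2 + lam)]. *)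
have [||le_w _] := @off_weight_le (Delta%:R + lam).
- by move: lam_ge; lra.
- by rewrite /w m0 /= da.
apply: lt_le_trans le_w; rewrite /bound_on; move: lam_ge; nra.
Qed.

End OffCycle.

(** * Graphs attaining a bound are isomorphic to the models *)

Section Extremal.
Local Open Scope nat_scope.

Variables (G : sgraph) (s : seq G) (p : G -> G) (Delta : nat) (a : G).
Hypotheses (conG : connected G) (orG : oriented s p).
Hypotheses (D3 : 2 < Delta) (da : deg a = Delta).

Let size_s_gt2 := or_size orG.

Lemma nth_ordS (x0 : G) (i : 'I_(size s)) : nth x0 s (ordS i) = p (nth x0 s i).
Proof.
by rewrite (or_next orG) ?mem_nth // nth_next ?(or_uniq orG).
Qed.

Lemma cycle_hom (x0 : G) (i j : cycle_graph (size s)) :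
  adj i j -> adj (nth x0 s i) (nth x0 s j).
Proof.
rewrite cycle_adjE ?(ltn_trans _ size_s_gt2) //.
by case/orP=> /eqP->; rewrite nth_ordS ?[adj (p _) _]adj_sym (adj_parent orG).
Qed.

(** The model is mapped into [G] by [iso_of_hom]: its cycle onto [s], its leaves onto the children
    of [a] off the cycle, which degree 1 keeps apart from [s]. *)
Lemma iso_U3_graph : a \in s ->
    (forall x, x != a -> deg x <= 2) ->
    (forall v, p v = a -> v != prev s a -> deg v = 1) ->
  exists i : cycle_graph (size s),
    isomorphic G (identify i (center (Delta - 2))).
Proof.
move=> sa le2 leaf.
have lt_ia : index a s < size s by rewrite index_mem.
pose i0 : cycle_graph (size s) := Ordinal lt_ia.
have ga : nth a s i0 = a by rewrite nth_index.
exists i0; pose L := enum [set v | (p v == a) && (v != prev s a)].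
have sizeL : size L = Delta - 2.
  rewrite -cardE (_ : [set v | _] = [set v | p v == a] :\ prev s a); last first.
    by apply/setP=> v; rewrite !inE andbC.
  have := cardsD1 (prev s a) [set v | p v == a].
  by rewrite inE parent_prev // eqxx (card_children orG) da; lia.
have memL j : j < Delta - 2 -> p (nth a L j) = a /\ deg (nth a L j) = 1.
  rewrite -sizeL => /(mem_nth a); rewrite mem_enum inE => /andP[/eqP pv nv].
  by split; [|apply: leaf].
(* The value [a] in the last branch is a dummy, the centre being excluded from the subtype. *)
pose g (x : identify i0 (center (Delta - 2))) : G := match x with
  | inl i => nth a s i
  | inr v => if val v is Some j then nth a L j else a end.
have nths (i : 'I_(size s)) : nth a s i \in s by rewrite mem_nth.
apply: (@iso_of_hom _ _ g (inl i0)) => //.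
- case=> [i|[[i|] //= ?]] [j|[[j|] //= ?]] /= /eqP eg.
  + by move: eg; rewrite nth_uniq ?(or_uniq orG) // => /eqP/val_inj->.
  + have := deg_cycle orG (nths i).
    by rewrite (eqP eg); have [_ ->] := memL j (ltn_ord j).
  + have := deg_cycle orG (nths j).
    by rewrite -(eqP eg); have [_ ->] := memL i (ltn_ord i).
  + move: eg; rewrite nth_uniq ?enum_uniq ?sizeL // => /eqP/val_inj eij.
    by congr inr; apply: val_inj; rewrite /= eij.
- have al (j : 'I_(Delta - 2)) : adj a (nth a L j).
    by rewrite adj_sym -{2}(memL j (ltn_ord j)).1 (adj_parent orG).
  case=> [i|[[i|] //= ?]] [j|[[j|] //= ?]] //=.
  + exact: cycle_hom.
  + by case/andP=> /eqP-> _; rewrite [X in adj X _]ga.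
  + by case/andP=> /eqP-> _; rewrite adj_sym [X in adj X _]ga.
- case=> [i|[[i|] //= ?]].
  + rewrite identify_degl cycle_deg // center_deg.
    have [->|ni] := eqVneq i i0; first by rewrite [g _]ga da mul1n subnKC // ltnW.
    rewrite addn0; apply: le2; rewrite /= -[X in _ != X]ga.
    by rewrite nth_uniq ?(or_uniq orG).
  + by rewrite identify_degr leaf_deg; have [_ ->] := memL i (ltn_ord i).
Qed.

(** The inner path vertex [i] goes to step [i.+1] of the orbit of [a]. Injectivity rests on degree 1
    for the leaves, on [nsi] for path against cycle, and on [iter_inj] along the path. *)
Lemma iso_U2_graph m : let b := iter m.+1 p a in
    a \notin s -> b \in s -> (forall i, i <= m -> iter i p a \notin s) -> 0 < m ->
    deg b = 3 -> (forall x, x != a -> x != b -> deg x <= 2) ->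
    (forall v, p v = a -> deg v = 1) ->
  exists i : cycle_graph (size s), isomorphic G (U2_graph Delta m.+1 i).
Proof.
move=> b sa sb nsi m0 db le2 leaf.
have itinj := iter_inj sa sb nsi.
have lt_ib : index b s < size s by rewrite index_mem.
pose i0 : cycle_graph (size s) := Ordinal lt_ib.
have gb : nth a s i0 = b by rewrite nth_index.
exists i0; pose L := enum [set v | p v == a].
have sizeL : size L = Delta.-1 by rewrite -cardE (card_children orG) da.
have memL j : j < Delta.-1 -> p (nth a L j) = a /\ deg (nth a L j) = 1.
  rewrite -sizeL => /(mem_nth a); rewrite mem_enum inE => /eqP pv.
  by split; [|apply: leaf].
pose H := dunion (cycle_graph (size s)) (star Delta.-1).
pose g (x : U2_graph Delta m.+1 i0) : G := match x with
  | inl (inl i) => nth a s i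
  | inl (inr (Some j)) => nth a L j
  | inl (inr None) => a
  | inr i => iter i.+1 p a end.
have nths (i : 'I_(size s)) : nth a s i \in s by rewrite mem_nth.
have nsa (i : 'I_(size s)) : nth a s i != a by apply: contraNneq sa => <-.
have degL (j : 'I_Delta.-1) : deg (nth a L j) = 1 by have [] := memL j (ltn_ord j).
have nsL (i : 'I_(size s)) (j : 'I_Delta.-1) : nth a s i != nth a L j.
  by apply/eqP=> e; have := deg_cycle orG (nths i); rewrite e degL.
have npL (x : G) (j : 'I_Delta.-1) : p x != nth a L j.
  by apply/eqP=> e; have := deg_parent orG x; rewrite e degL.
have naL (j : 'I_Delta.-1) : a != nth a L j.
  by apply/eqP=> e; have := D3; rewrite -da e degL.
have nsp (i : 'I_(size s)) (j : 'I_m) : nth a s i != p (iter j p a).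
  by apply: contraNneq (nsi j.+1 (ltn_ord j)) => /= <-.
have nap (j : 'I_m) : p (iter j p a) != a.
  by apply/eqP=> /(itinj j.+1 0 (ltn_ord j) (leq0n _)).
have ab : (inr (center Delta.-1) : H) != inl i0 by [].
have m1 : 1 < m.+1 by [].
apply: (@iso_of_hom _ _ g (inr (Ordinal m0))) => //.
- case=> [[i|[i|]]|i] [[j|[j|]]|j] eg.
  + move/eqP: eg; rewrite /g nth_uniq ?(or_uniq orG) // => /eqP/val_inj->.
    by [].
  + by case/eqP: (nsL i j).
  + by case/eqP: (nsa i).
  + by case/eqP: (nsp i j).
  + by case/eqP: (nsL j i).
  + move/eqP: eg; rewrite /g nth_uniq ?enum_uniq ?sizeL // => /eqP/val_inj->.
    by [].
  + by case/eqP: (naL i).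
  + by case/eqP: (npL (iter j p a) i).
  + by case/eqP: (nsa j).
  + by case/eqP: (naL j).
  + by [].
  + by case/eqP: (nap j).
  + by case/eqP: (nsp j i).
  + by case/eqP: (npL (iter i p a) j).
  + by case/eqP: (nap i).
  + have /eq_add_S/val_inj-> // := itinj i.+1 j.+1 (ltn_ord i) (ltn_ord j) eg.
- have al (j : 'I_Delta.-1) : adj a (nth a L j).
    by rewrite adj_sym -{2}(memL j (ltn_ord j)).1 (adj_parent orG).
  have pe (i : 'I_m) (x : H) : 
     (x == inr None) && (i == 0 :> nat) || (x == inl i0) && (i.+1 == m) ->
     adj (g (inl x)) (iter i.+1 p a).
    case/orP=> /andP[/eqP-> /eqP ei]; first by rewrite ei (adj_parent orG).
    by rewrite [g _]gb ei adj_sym (adj_parent orG).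
  case=> [x|i] [y|j].
  + case: x y => [i|[i|]] [j|[j|]] //= => [|_]; last by rewrite adj_sym.
    exact: cycle_hom.
  + exact: pe.
  + by move/pe; rewrite adj_sym.
  + by case/orP=> /eqP e; rewrite /g -e ?[adj (iter _.+2 _ _) _]adj_sym (adj_parent orG).
- case=> [[i|[i|]]|i].
  + rewrite add_path_degl // !dunion_deg cycle_deg //= addn0.
    have [->|ni] := eqVneq i i0; first by rewrite gb db eqxx.
    rewrite (_ : (inl i == inl i0 :> H) = false) ?addn0; last exact: negbTE ni.
    apply: le2 => //; rewrite -gb nth_uniq ?(or_uniq orG) //.
  + by rewrite add_path_degl // !dunion_deg leaf_deg /= degL.
  + rewrite add_path_degl // !dunion_deg center_deg /= da; lia.
  + rewrite add_path_degr //; apply: le2; first exact: nap.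
    by apply: contraNneq (nsi i.+1 (ltn_ord i)) => e; move: sb; rewrite -e.
Qed.
End Extremal.

(** * Degree data of the models *)

Section ModelShapes.
Local Open Scope nat_scope.

Lemma ndeg_const (G : sgraph) (x : G) (d : nat) :
  (forall y, adj x y -> deg y = d) -> ndeg x = deg x * d.
Proof.
move=> degd; rewrite deg_sum big_distrl /ndeg; apply: eq_bigr => y _ /=.
by case xy: (adj x y); rewrite // !mul1n degd.
Qed.

(** Two cycle neighbours of degree 2 and [Delta - 2] leaves around [a] give [Delta + 2], as
    [GRM_shape_on] requires. *)
Lemma U3_shape (G : sgraph) (n Delta : nat) :
    2 < Delta -> Delta < n -> is_U3 n Delta G ->
  exists a : G, [/\ deg a = Delta, forall x, x != a -> deg x <= 2
                  & ndeg a = Delta + 2].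
Proof.
move=> D3 Dn [a0 [f [h fK hK] fadj]].
have k2 : 2 < n - (Delta - 2) by lia.
have degf := iso_deg (Bijective fK hK) fadj.
have deg_a0 : deg (inl a0 : U3_graph a0) = Delta.
  by rewrite identify_degl cycle_deg // eqxx center_deg; lia.
exists (h (inl a0)); split; first by rewrite -degf hK.
- move=> x; rewrite eq_sym (can2_eq hK fK) eq_sym -degf; case: (f x) => [i|v].
    move=> ni; rewrite identify_degl cycle_deg //.
    by rewrite (_ : (i == a0) = false) //; apply: negbTE.
  by rewrite identify_degr; case: v => -[j|] //= _; rewrite leaf_deg.
- rewrite -(iso_ndeg (Bijective fK hK) fadj) hK /ndeg big_sumType /=.
  rewrite (eq_bigr (fun i => adj (a0 : cycle_graph _) i * 2)) => [|i _]; last first.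
    rewrite identify_degl cycle_deg //.
    have [->|_] := eqVneq i a0; first by rewrite /= cycle_adj_irr.
    by rewrite addn0.
  rewrite (cycle_sum a0 (fun=> 2)) // eqxx.
  rewrite (eq_bigr (fun v => adj (center (Delta - 2)) (val v) * 1)) => [|[[j|] //= ?] _].
    rewrite (sum_neq (center _) (fun v => adj (center (Delta - 2)) v * 1)).
    have := star_sum (m := Delta - 2) (fun=> 1).
    rewrite (bigD1 (center _)) //= mul0n add0n => ->; rewrite sum1_card card_ord; lia.
  by rewrite identify_degr leaf_deg.
Qed.

(** Around [a] there are [Delta - 1] leaves and one path vertex of degree 2; the three neighbours of
    [b] all have degree 2. This feeds [GRM_shape_off]. *)
Lemma U2_shape (G : sgraph) (Delta k l : nat) (b0 : cycle_graph k) :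
    2 < Delta -> 2 < k -> 1 < l -> isomorphic G (U2_graph Delta l b0) ->
  exists a b : G, [/\ a != b, ~~ adj a b, deg a = Delta & deg b = 3] /\
    [/\ forall x, x != a -> x != b -> deg x <= 2, ndeg a = Delta + 1 & ndeg b = 6].
Proof.
move=> D3 k2 l1 [f [h fK hK] fadj].
have bf := Bijective fK hK; have degf := iso_deg bf fadj.
pose H := dunion (cycle_graph k) (star Delta.-1).
have ab : (inr (center Delta.-1) : H) != inl b0 by [].
have deg_path i : deg (inr i : U2_graph Delta l b0) = 2 by rewrite add_path_degr.
have deg_leaf j : deg (inl (inr (Some j)) : U2_graph Delta l b0) = 1.
  by rewrite add_path_degl // !dunion_deg leaf_deg.
have deg_cyc i : i != b0 -> deg (inl (inl i) : U2_graph Delta l b0) = 2.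
  move=> ni; rewrite add_path_degl // !dunion_deg cycle_deg // addn0.
  by rewrite (_ : (inl i == inl b0 :> H) = false) //; apply: negbTE.
have deg_b : deg (inl (inl b0) : U2_graph Delta l b0) = 3.
  by rewrite add_path_degl // !dunion_deg cycle_deg // eqxx.
have deg_a : deg (inl (inr (center Delta.-1)) : U2_graph Delta l b0) = Delta.
  by rewrite add_path_degl // !dunion_deg center_deg eqxx addn0; lia.
exists (h (inl (inr (center Delta.-1)))), (h (inl (inl b0))).
split; split.
- by rewrite (can_eq hK).
- by rewrite -fadj !hK.
- by rewrite -degf hK.
- by rewrite -degf hK.
- move=> x; rewrite ![x == _]eq_sym !(can2_eq hK fK) ![_ == f x]eq_sym -degf.
  case: (f x) => [[i|[j|]]|i] //.
  + by move=> _ ni; rewrite deg_cyc.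
  + by rewrite deg_leaf.
  + by rewrite deg_path.
- rewrite -(iso_ndeg bf fadj) hK /ndeg !big_sumType /= big1 // add0n.
  rewrite (star_sum (fun j => deg (inl (inr j) : U2_graph Delta l b0))).
  rewrite [X in X + _](eq_bigr (fun=> 1)) //= sum1_card card_ord.
  case: l l1 {f h fK hK fadj bf degf deg_leaf deg_cyc deg_b deg_a} deg_path => [|[|l']] // _ deg_path.
  rewrite (eq_bigr (fun i => (i == ord0) * 2)) => [|i _]; last by rewrite deg_path orbF.
  rewrite (sum_eq_l (ord0 : 'I_l'.+1) (fun=> 2)); lia.
- rewrite -(iso_ndeg bf fadj) hK (ndeg_const (d := 2)) ?deg_b //.
  case=> [[i|j]|i] //= bi; apply: deg_cyc.
  by apply: contraTneq bi => ->; rewrite /= cycle_adj_irr.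
Qed.

End ModelShapes.

(** * Comparison with the two bounds, and the theorem *)

Lemma ex_max_deg (G : sgraph) : (0 < max_deg G)%N -> exists a : G, deg a = max_deg G.
Proof.
case: (posnP #|G|) => [/card0_eq G0|G0 _]; last first.
  by have [a _ e] := eq_bigmax_cond (@deg G) G0; exists a.
by rewrite /max_deg big_pred0.
Qed.

Lemma deg_lt_card (G : sgraph) (x : G) : (deg x < #|G|)%N.
Proof.
by rewrite -cardsT proper_card // properE subsetT; apply/subsetPn; exists x; rewrite ?inE ?adj_irr.
Qed.

Section Dichotomy.
Variables (R : realFieldType) (lam : R) (n Delta : nat) (U : sgraph).
Hypotheses (lam_ge : - (1 / 2) <= lam) (D3 : (3 <= Delta)%N) (hU : in_U U n Delta).

Lemma GRM_U3 : is_U3 n Delta U -> GRM U lam = bound_on lam n Delta.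
Proof.
case: hU => uU <- mU; have [s [p orU]] := unicyclic_oriented uU.
have [|a0 da0] := @ex_max_deg U; first by rewrite mU (ltn_trans _ D3).
case/(U3_shape D3) => [|a [da le2 na]]; first by rewrite -mU -da0 deg_lt_card.
exact: (GRM_shape_on _ orU) da le2 D3 na.
Qed.

Lemma GRM_U2 : in_U2 n Delta U -> GRM U lam = bound_off lam n Delta.
Proof.
case: hU => uU <- mU [_ [k [l [k3 l2 [b0]]]]].
have [s [p orU]] := unicyclic_oriented uU.
case/(U2_shape D3 k3 l2)=> a [b [[ab nab da db] [le2 na nb]]].
exact: (GRM_shape_off _ orU) ab nab da db le2 D3 na nb.
Qed.

(** The first alternative covers [a] or [p a] on the cycle; in the latter case the inequality is
    strict and the equality claim is void. The last clause of the second holds because so small an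
    [n] forces [p a] onto the cycle. *)
Lemma bound_dichotomy :
  (bound_on lam n Delta <= GRM U lam /\
   (GRM U lam = bound_on lam n Delta -> is_U3 n Delta U)) \/
  [/\ bound_off lam n Delta <= GRM U lam,
      GRM U lam = bound_off lam n Delta -> in_U2 n Delta U
    & (n <= Delta + 3)%N -> bound_on lam n Delta < GRM U lam].
Proof.
have [uU cU mU] := hU; have [s [p orU]] := unicyclic_oriented uU.
have conU : connected U by case: uU.
have [|a da] := @ex_max_deg U; first by rewrite mU (ltn_trans _ D3).
rewrite mU in da.
have [sa|sa] := boolP (a \in s).
  left; have [le_on eq_on] := bound_on_le lam_ge orU sa da D3.
  rewrite -cU; split=> // /eq_on[le2 leaf].
  have [i isoU] := iso_U3_graph conU orU D3 da sa le2 leaf.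
  (* Counting vertices identifies [size s] with the cycle length [n - (Delta - 2)] of the model. *)
  have -> : #|U| = (size s + (Delta - 2))%N.
    rewrite (iso_card isoU) card_sum card_ord; congr (_ + _)%N.
    have := card_sig (fun v : star (Delta - 2) => v != center _).
    rewrite -[LHS]/#|{: {v | v != center (Delta - 2)}}| => ->.
    by have := cardC1 (center (Delta - 2)); rewrite card_option card_ord.
  by rewrite /is_U3 /U3_graph addnK; exists i.
have [m [sb nsi]] := entry_point orU sa.
have [spa|spa] := boolP (p a \in s).
  left; have lt_on := bound_on_lt_near orU sa sb nsi lam_ge da D3 spa.
  rewrite -cU; split; first exact: ltW.
  by move=> e; rewrite e ltxx in lt_on.
right; have [le_off eq_off] := bound_off_le_far orU sa sb nsi lam_ge da D3 spa.
rewrite -cU; split=> // [/eq_off[db le2 leaf]|n3].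
  have m0 : (0 < m)%N by case: (m) sb spa => //= ->.
  split; first by rewrite cU.
  have [i isoU] := iso_U2_graph conU orU D3 da sa sb nsi m0 db le2 leaf.
  exists (size s), m.+1; split=> //; [exact: or_size orU | by exists i].
case/negP: spa; apply: (parent_mem_of_card orU sa); rewrite da; lia.
Qed.

End Dichotomy.

Theorem theorem2 (R : realFieldType) (lambda : R) (n Delta : nat) (U : sgraph)
    (hlambda : - (1 / 2) <= lambda) (hDelta : (3 <= Delta)%N)
    (hU : in_U U n Delta) :
  [/\ 2 * lambda + 6 < Delta%:R /\ Delta%:R < n%:R - 3 :> R ->
      let bound := (Delta%:R + lambda) * (Delta%:R + Delta%:R * lambda + 1)
                   + (n%:R - Delta%:R) * (2 + lambda) ^+ 2
                   + 3 * (2 + lambda) in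
      bound <= GRM U lambda /\ (GRM U lambda = bound <-> in_U2 n Delta U),
      ((3 <= Delta)%N /\ Delta%:R < 2 * lambda + 6) \/
      (n%:R - 3 <= Delta%:R :> R /\ Delta%:R <= n%:R - 1 :> R) ->
      let bound := (Delta%:R + lambda) * (Delta%:R + Delta%:R * lambda + 2)
                   + (n%:R - Delta%:R) * (2 + lambda) ^+ 2 in
      bound <= GRM U lambda /\ (GRM U lambda = bound <-> is_U3 n Delta U)
    & Delta%:R = 2 * lambda + 6 ->
      let bound := 6 * (2 + lambda) ^+ 3
                   + (n%:R - 2 * lambda - 6) * (2 + lambda) ^+ 2 in
      bound <= GRM U lambda /\
      (GRM U lambda = bound <-> in_U2 n Delta U \/ is_U3 n Delta U)].
Proof.
have on3 := GRM_U3 lambda hDelta hU.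
have off2 := GRM_U2 lambda hDelta hU.
(* The sign of this difference decides which bound is the smaller one, and so separates the three
   cases. *)
have diff : bound_on lambda n Delta - bound_off lambda n Delta
          = Delta%:R - (2 * lambda + 6) by rewrite /bound_on /bound_off; ring.
have dich := bound_dichotomy hlambda hDelta hU.
split.
- case=> Dl Dn bound; rewrite -/(bound_off lambda n Delta) in bound *.
  case: dich => [[le_on _]|[le_off eq_off _]]; last by split.
  have lt_off : bound_off lambda n Delta < GRM U lambda by move: le_on; lra.
  split; first exact: ltW.
  by split=> // e; rewrite /bound e ltxx in lt_off.
- move=> cond bound; rewrite -/(bound_on lambda n Delta) in bound *.
  case: dich => [[le_on eq_on]|[le_off _ lt_on]]; first by split.
  have {}lt_on : bound_on lambda n Delta < GRM U lambda.
    (* Either [bound_on] lies strictly below [bound_off], or [n <= Delta + 3] and the last clause of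
       the dichotomy applies. *)
    case: cond => [[_ Dl]|[nD _]]; first by move: le_off; lra.
    apply: lt_on; rewrite -(ler_nat R) natrD; lra.
  split; first exact: ltW.
  by split=> // e; rewrite /bound e ltxx in lt_on.
- move=> eqD bound.
  have b_on : bound = bound_on lambda n Delta by rewrite /bound /bound_on eqD; ring.
  have b_off : bound = bound_off lambda n Delta.
    by move: diff; rewrite eqD subrr b_on => /subr0_eq.
  split; first by case: dich => [[]|[]]; rewrite -?b_on -?b_off.
  split=> [e|[/off2|/on3] ->] //; case: dich => [[_ eq_on]|[_ eq_off _]].
  + by right; apply: eq_on; rewrite e.
  + by left; apply: eq_off; rewrite e.
Qed.
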